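(* Let $\mathbf{x}$ be the solution on $[t_0,T]$ of $\mathbf{x}'(t)=\mathbf{f}(t,\mathbf{x}(t))$, $\mathbf{x}(t_0)=\mathbf{x}_0$, with $\mathbf{f}\in\mathcal{C}^{\gamma+1}([t_0,T]\times\mathcal{D},\mathbb{R}^d)$. With $t_n,t_{n+1}\in(t)_h$, let $$\widetilde{\mathbf{z}}_{n+1}=\widetilde{\mathbf{z}}_n+h_n\Lambda_1(t_n,\widetilde{\mathbf{z}}_n;h_n)\quad\text{and}\quad\widetilde{\mathbf{v}}_{n+1}=\widetilde{\mathbf{v}}_n+h_n\Lambda_2^{\widetilde{\mathbf{z}}_n}(t_n,\widetilde{\mathbf{v}}_n;h_n)$$ be one-step explicit integrators of the linear ODE (L) and of the auxiliary ODE (A) of the context, respectively. Suppose that these integrators have order of convergence $r$ and $p$, respectively, and that $\Lambda_1$ and $\Lambda_2^{\widetilde{\mathbf{z}}_n}$ fulfill the local Lipschitz condition of the context. Then, for $h$ small enough, the numerical scheme $$\widetilde{\mathbf{y}}_{n+1}=\widetilde{\mathbf{y}}_n+h_n\Lambda_1(t_n,\widetilde{\mathbf{y}}_n;h_n)+h_n\Lambda_2^{\widetilde{\mathbf{y}}_n}(t_n,\mathbf{0};h_n),\qquad\widetilde{\mathbf{y}}_0=\mathbf{x}_0,$$ satisfies $$\Vert\mathbf{x}(t_{n+1})-\widetilde{\mathbf{y}}_{n+1}\Vert\le Ch^{\min\{r,p\}}$$ for all $t_{n+1}\in(t)_h$, where $C$ is a positive constant.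
   Context: $\mathcal{D}\subset\mathbb{R}^d$ is open, $\mathbf{x}_0\in\mathcal{D}$, the ODE has a unique solution $\mathbf{x}$ on $[t_0,T]$ with values in $\mathcal{D}$, and $\gamma>2$ is an integer. $\mathbf{f}_{\mathbf{x}},\mathbf{f}_t$ are the partial derivatives of $\mathbf{f}$. For $0<h<1$, $(t)_h$ is a partition $t_0<t_1<\dots<t_N=T$ with $h_n=t_{n+1}-t_n\le h$. $C$ is independent of $h$ and of the partition. Linear ODE (L): for $t\in[t_n,t_{n+1}]$, $\mathbf{z}'(t)=\mathbf{B}_n\mathbf{z}(t)+\mathbf{b}_n(t)$, $\mathbf{z}(t_n)=\widetilde{\mathbf{y}}_n$, where $\mathbf{B}_n=\mathbf{f}_{\mathbf{x}}(t_n,\widetilde{\mathbf{y}}_n)$ and $\mathbf{b}_n(t)=\mathbf{f}_t(t_n,\widetilde{\mathbf{y}}_n)(t-t_n)+\mathbf{f}(t_n,\widetilde{\mathbf{y}}_n)-\mathbf{B}_n\widetilde{\mathbf{y}}_n$. Auxiliary ODE (A): for $t\in[t_n,t_{n+1}]$, $\mathbf{v}'(t)=\widetilde{\mathbf{q}}(t_n,\widetilde{\mathbf{y}}_n;t,\mathbf{v}(t))$, $\mathbf{v}(t_n)=\mathbf{0}$, with $$\widetilde{\mathbf{q}}(t_n,\widetilde{\mathbf{y}}_n;s,\boldsymbol{\xi})=\mathbf{f}(s,\widetilde{\mathbf{y}}_n+\widetilde{\boldsymbol{\phi}}(t_n,\widetilde{\mathbf{y}}_n;s-t_n)+\boldsymbol{\xi})-\mathbf{f}_{\mathbf{x}}(t_n,\widetilde{\mathbf{y}}_n)\widetilde{\boldsymbol{\phi}}(t_n,\widetilde{\mathbf{y}}_n;s-t_n)-\mathbf{f}_t(t_n,\widetilde{\mathbf{y}}_n)(s-t_n)-\mathbf{f}(t_n,\widetilde{\mathbf{y}}_n),$$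 where $\widetilde{\boldsymbol{\phi}}(t_n,\widetilde{\mathbf{y}}_n;\delta)=\delta\Lambda_1(t_n,\widetilde{\mathbf{y}}_n;\delta)$ is the increment given by the integrator of (L) (so $\widetilde{\mathbf{y}}_n+\widetilde{\boldsymbol{\phi}}(t_n,\widetilde{\mathbf{y}}_n;s-t_n)$ is the numerical solution of (L) at time $s$). The superscript in $\Lambda_2^{\widetilde{\mathbf{y}}_n}$ indicates the dependence of (A) on $\widetilde{\mathbf{y}}_n$. The orders $r$ and $p$ mean that, with $\widetilde{\mathbf{y}}_n=\mathbf{x}(t_n)$ in (L) and (A), the one-step errors satisfy, with constants $c_1,c_2$ independent of the step and of $n$, $\Vert\mathbf{z}(t_n+\delta)-\mathbf{z}(t_n)-\delta\Lambda_1(t_n,\mathbf{z}(t_n);\delta)\Vert\le c_1\delta^{r+1}$ and $\Vert\mathbf{v}(t_n+\delta)-\delta\Lambda_2^{\mathbf{x}(t_n)}(t_n,\mathbf{0};\delta)\Vert\le c_2\delta^{p+1}$ for step sizes $\delta$. Local Lipschitz condition: a map $F(s,\boldsymbol{\xi};h)$ satisfies it if every $\boldsymbol{\xi}\in\mathcal{D}$ has a neighborhood $\epsilon(\boldsymbol{\xi})\subset\mathcal{D}$ and a constant $B_\epsilon>0$ with $\Vert F(s,\boldsymbol{\xi}_2;h)-F(s,\boldsymbol{\xi}_1;h)\Vert\le B_\epsilon\Vert\boldsymbol{\xi}_2-\boldsymbol{\xi}_1\Vert$ for all $\boldsymbol{\xi}_1,\boldsymbol{\xi}_2\in\epsilon(\boldsymbol{\xi})$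 (and all $s,h$). It is applied to $F=\Lambda_1$ and to $F(s,\boldsymbol{\xi};h)=\Lambda_2^{\boldsymbol{\xi}}(s,\mathbf{0};h)$. *)

(* Defs.v *)
From HB Require Import structures.
From mathcomp Require Import all_boot all_order all_algebra.
From mathcomp Require Import all_classical all_reals all_analysis.

Set Implicit Arguments.
Unset Strict Implicit.
Unset Printing Implicit Defensive.

Import Order.TTheory GRing.Theory Num.Theory.
Import numFieldNormedType.Exports.

Local Open Scope classical_set_scope.
Local Open Scope ring_scope.

(* Derivatives relative to a set of times A; for A = `[a, b] they are
   one-sided at the end points and two-sided in between. *)
Section derivative_within.
Context {R : realType} {V : normedModType R}.
Implicit Types (A : set R) (u : R -> V) (t : R).

Definition diff_quot_within A u t :=
  (fun h => h^-1 *: (u (t + h) - u t)) @ within [set h | A (t + h)] 0^'.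

Definition derivable_within A u t := cvg (diff_quot_within A u t).

Definition derive_within A u t : V := lim (diff_quot_within A u t).

Definition is_derive_within A u t (l : V) := diff_quot_within A u t --> l.

(* u' = F(t, u) on [a, b], u(a) = u0.  F(t, .) is only meaningful on dom t,
   and the graph of u has to stay there. *)
Definition ivp_solution (dom : R -> set V) (F : R -> V -> V) (a b : R)
    (u0 : V) (u : R -> V) : Prop :=
  u a = u0 /\
  forall t, t \in `[a, b] ->
    dom t (u t) /\ is_derive_within `[a, b] u t (F t (u t)).

End derivative_within.

Section partial_derivatives.
Context {R : realType} {d : nat}.
Local Notation V := 'cV[R]_d.
Implicit Types (I : set R) (D : set V) (f : R -> V -> V).

Definition partial_t I f (t : R) (xi : V) : V := derive_within I (f^~ xi) t.

Definition partial_x (j : 'I_d) f (t : R) (xi : V) : V :=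
  'D_(delta_mx j 0) (f t) xi.

Definition jacobian_x f (t : R) (xi : V) : 'M[R]_d :=
  \matrix_(i, j) partial_x j f t xi i 0.

(* f is of class C^k on I x D: all partial derivatives of order at most k
   exist on I x D and are continuous there.  D is meant to be open. *)
Fixpoint class_C (k : nat) I D f : Prop :=
  {within I `*` D, continuous (fun p : R * V => f p.1 p.2)} /\
  match k with
  | 0 => True
  | k'.+1 =>
    [/\ forall t xi, I t -> D xi -> derivable_within I (f^~ xi) t,
        forall j t xi, I t -> D xi -> derivable (f t) xi (delta_mx j 0),
        class_C k' I D (partial_t I f) &
        forall j, class_C k' I D (partial_x j f)]
  end.

End partial_derivatives.

Section integrators.
Context {R : realType} {d : nat}.
Local Notation V := 'cV[R]_d.
Implicit Types (I : set R) (D : set V) (f : R -> V -> V) (s t : R) (y : V).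
(* Lambda1 t_n z_n h_n and Lambda2 y_n t_n v_n h_n are the increment functions
   of the integrators of the linear ODE and of the auxiliary ODE; the first
   two arguments of Lambda1 determine the linear ODE as well as its initial
   condition. *)
Local Notation increment := (R -> V -> R -> V).
Local Notation increment_family := (V -> R -> V -> R -> V).

Definition linear_rhs I f s y t (z : V) : V :=
  jacobian_x f s y *m z
  + ((t - s) *: partial_t I f s y + f s y - jacobian_x f s y *m y).

Definition phi_increment (Lambda1 : increment) s y (delta : R) : V :=
  delta *: Lambda1 s y delta.

Definition auxiliary_rhs I f (Lambda1 : increment) s y t (xi : V) : V :=
  f t (y + phi_increment Lambda1 s y (t - s) + xi)
  - jacobian_x f s y *m phi_increment Lambda1 s y (t - s)
  - (t - s) *: partial_t I f s y - f s y.

(* f, hence the auxiliary right-hand side, is only meaningful when its space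
   argument lies in D. *)
Definition auxiliary_dom D (Lambda1 : increment) s y t : set V :=
  [set xi | D (y + phi_increment Lambda1 s y (t - s) + xi)].

(* In the two notions of order, s ranges over all possible grid points and
   delta over the step sizes up to some positive delta0.  The exact solutions
   z and v over one step are unique whenever f is C^1, so that "exists" only
   asserts that there is an exact solution to compare with. *)
Definition linear_order (t0 T : R) f (x : R -> V) (Lambda1 : increment) (r : R)
    : Prop :=
  exists c delta0 : R, 0 < delta0 /\
  forall s delta, t0 <= s -> 0 < delta <= delta0 -> s + delta <= T ->
  exists2 z : R -> V,
    ivp_solution (fun=> setT) (linear_rhs `[t0, T] f s (x s))
      s (s + delta) (x s) z &
    `|z (s + delta) - z s - delta *: Lambda1 s (z s) delta|
      <= c * delta `^ (r + 1).

Definition auxiliary_order (t0 T : R) D f (x : R -> V) (Lambda1 : increment)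
    (Lambda2 : increment_family) (p : R) : Prop :=
  exists c delta0 : R, 0 < delta0 /\
  forall s delta, t0 <= s -> 0 < delta <= delta0 -> s + delta <= T ->
  exists2 v : R -> V,
    ivp_solution (auxiliary_dom D Lambda1 s (x s))
      (auxiliary_rhs `[t0, T] f Lambda1 s (x s)) s (s + delta) 0 v &
    `|v (s + delta) - delta *: Lambda2 (x s) s 0 delta|
      <= c * delta `^ (p + 1).

Definition locally_lipschitz (t0 T : R) D (F : increment) : Prop :=
  forall xi, D xi ->
  exists2 U : set V, nbhs xi U /\ U `<=` D &
  exists2 B : R, 0 < B &
    forall s h xi1 xi2, t0 <= s <= T -> 0 < h < 1 -> U xi1 -> U xi2 ->
    `|F s xi2 h - F s xi1 h| <= B * `|xi2 - xi1|.

(* t_0 < ... < t_N; the values of t beyond N are irrelevant. *)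
Definition time_partition (t0 T h : R) (N : nat) (t : nat -> R) : Prop :=
  [/\ t 0%N = t0, t N = T &
      forall n, (n < N)%N -> t n < t n.+1 /\ t n.+1 - t n <= h].

Definition composite_scheme (Lambda1 : increment)
    (Lambda2 : increment_family) (N : nat) (t : nat -> R) (x0 : V)
    (y : nat -> V) : Prop :=
  y 0%N = x0 /\
  forall n, (n < N)%N ->
    let hn := t n.+1 - t n in
    y n.+1 = y n + hn *: Lambda1 (t n) (y n) hn
                 + hn *: Lambda2 (y n) (t n) 0 hn.

End integrators.

(* Main.v *)
(* Let z and v be the exact solutions over one step, started from x(t_n), and
   let g = z - (x(t_n) + phi) be the error of the linear integrator, so that
   |g| = O(delta^(r+1)).  Because phi replaces the exact increment of z in the
   auxiliary ODE, z + v need not equal x; its deviation e = z + v - x solves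
     e' = f(t, x + e - g) - f(t, x) + f_x(t_n, x(t_n)) g,   e(t_n) = 0,
   hence |e| is at most of the order of |g|, and the local error
     x(t_(n+1)) - x(t_n) - delta Lambda1 - delta Lambda2
       = - e + (z - z_n - delta Lambda1) + (v - delta Lambda2)
   is O(delta^(min(r,p)+1)).  By compactness of [t0, T], f(t, .) and the
   increment functions are Lipschitz with uniform constants on a tube around
   the graph of x, and local errors accumulate by a discrete Gronwall argument
   which for small h also keeps the scheme inside the tube. *)

Require Import Defs.
From HB Require Import structures.
From mathcomp Require Import all_boot all_order all_algebra.
From mathcomp Require Import all_classical all_reals all_analysis.
From mathcomp Require Import ring lra.
Import Order.TTheory GRing.Theory Num.Theory.
Import numFieldNormedType.Exports.
Local Open Scope classical_set_scope.
Local Open Scope ring_scope.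

(** * Calculus of one-sided and relative derivatives *)

Section derivatives_within.
Context {R : realType} {V : normedModType R}.
Implicit Types (A B : set R) (u v : R -> V) (t : R).

(** Multiplying the difference quotient by [|k|] makes the estimate trivial at [k = 0], so the
    punctured neighbourhood becomes a full one. *)
Lemma is_derive_withinP A u t (l : V) :
  is_derive_within A u t l <->
  forall e, 0 < e -> \forall k \near 0, A (t + k) ->
    `|u (t + k) - u t - k *: l| <= e * `|k|.
Proof.
have E k : k != 0 -> `|u (t + k) - u t - k *: l| =
    `|k| * `|l - k^-1 *: (u (t + k) - u t)|.
  move=> k0; rewrite -normrZ scalerBr scalerA divff// scale1r.
  by rewrite [LHS]distrC.
rewrite /is_derive_within; split.
  move=> /cvgrPdist_le H e e0; have := H _ e0; rewrite near_withinE.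
  rewrite /dnbhs near_withinE; apply: filterS => k Hk Ak.
  have [->|k0] := eqVneq k 0.
    by rewrite addr0 scale0r subrr subr0 !normr0 mulr0.
  by rewrite E// mulrC ler_wpM2r//; exact: Hk.
move=> H; apply/cvgrPdist_le => e e0; have := H _ e0; rewrite near_withinE.
rewrite /dnbhs near_withinE; apply: filterS => k Hk k0 Ak.
have := Hk Ak; rewrite E// mulrC ler_pM2r// normr_gt0//.
Qed.

Lemma is_derive_within_subset {A} B {u t} {l : V} : B `<=` A ->
  is_derive_within A u t l -> is_derive_within B u t l.
Proof.
move=> BA; apply: cvg_trans; apply: cvg_app; apply: within_subset => k.
exact: BA.
Qed.

Lemma is_derive_withinD {A u v t} {l m : V} :
  is_derive_within A u t l -> is_derive_within A v t m ->
  is_derive_within A (u \+ v) t (l + m).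
Proof.
move=> hu hv; rewrite /is_derive_within /diff_quot_within.
rewrite (_ : (fun _ => _) = (fun h => h^-1 *: (u (t + h) - u t)) \+
                            (fun h => h^-1 *: (v (t + h) - v t))).
  exact: cvgD.
by apply/funext => h /=; rewrite -scalerDr opprD addrACA.
Qed.

Lemma is_derive_withinB {A u v t} {l m : V} :
  is_derive_within A u t l -> is_derive_within A v t m ->
  is_derive_within A (u \- v) t (l - m).
Proof.
move=> hu hv; rewrite /is_derive_within /diff_quot_within.
rewrite (_ : (fun _ => _) = (fun h => h^-1 *: (u (t + h) - u t)) \-
                            (fun h => h^-1 *: (v (t + h) - v t))).
  exact: cvgB.
by apply/funext => h /=; rewrite -scalerBr; congr (_ *: _); rewrite !opprD opprK addrACA.
Qed.

Lemma is_derive_within_continuous {A u t} {l : V} :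
  is_derive_within A u t l ->
  forall e, 0 < e -> \forall k \near 0, A (t + k) -> `|u (t + k) - u t| < e.
Proof.
move=> /is_derive_withinP /(_ 1 ltr01) H e e0.
have l0 : 0 < 2 + `|l| by have := normr_ge0 l; lra.
have e1 : 0 < e / (2 + `|l|) by exact: divr_gt0.
near=> k => Ak.
have : `|u (t + k) - u t - k *: l| <= 1 * `|k| by move: Ak; near: k.
have k1 : `|k| < e / (2 + `|l|).
  by rewrite -[k]subr0 distrC; near: k; exact: (@cvgr_dist_lt _ _ _ _ _ id).
have := ler_normD (u (t + k) - u t - k *: l) (k *: l).
rewrite subrK normrZ mul1r => h1 h2.
rewrite ltr_pdivlMr// in k1.
have := normr_ge0 k; have := normr_ge0 l; nra.
Unshelve. all: by end_near.
Qed.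

(* The derivative is only constrained while the bound holds, so this contains
   both the mean value inequality and a bootstrap: a curve cannot leave the
   cone |e t| <= M (t - a) as long as its speed inside is less than M. *)
Lemma cone_invariance (a b M : R) (u du : R -> V) : 0 < M -> u a = 0 ->
  (forall t, a <= t <= b -> is_derive_within `[a, b] u t (du t)) ->
  (forall t, a <= t <= b -> `|u t| <= M * (t - a) -> `|du t| < M) ->
  forall t, a <= t <= b -> `|u t| <= M * (t - a).
Proof.
move=> M0 ua hd hb.
(* Continuous induction: [S] holds the times up to which the cone bound has never failed, and its
   supremum [c] is shown to lie in [S] and not before [t]. *)
pose S := [set t | a <= t <= b /\
  forall s, a <= s <= t -> `|u s| <= M * (s - a)].
move=> t tab; have ab : a <= b by case/andP: tab => /le_trans; apply.
have Sa : S a.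
  split; first by rewrite lexx.
  by move=> s /le_anti <-; rewrite ua normr0 subrr mulr0.
have Sub : has_ubound S by exists b => s [/andP[]].
have hS : has_sup S by split=> //; exists a.
pose c := sup S.
have ac : a <= c by exact: ub_le_sup.
have cb : c <= b by apply: ge_sup; [exists a|move=> s [/andP[]]].
have below s : a <= s -> s < c -> `|u s| <= M * (s - a).
  move=> as_ sc; have [s' [_ Ss'] ss'] := sup_gt (proj1 hS) sc.
  by apply: Ss'; rewrite as_ ltW.
(* The bound survives at [c] as a limit from the left: a violation would leave a gap that continuity
   of [u] rules out when compared with [c - k]. *)
have atc : `|u c| <= M * (c - a).
  have [->|ca] := eqVneq c a; first by rewrite ua normr0 subrr mulr0.
  rewrite leNgt; apply/negP => hlt.
  have e0 : 0 < `|u c| - M * (c - a) by rewrite subr_gt0.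
  have hdc := hd c; rewrite ac cb in hdc.
  have /nbhs_norm0P[/= eta eta0 He] := is_derive_within_continuous (hdc isT) _ e0.
  have ca' : a < c by rewrite lt_neqAle eq_sym ca.
  pose k := Num.min (eta / 2) (c - a).
  have k0 : 0 < k by rewrite lt_min divr_gt0//= subr_gt0.
  have k1 : k < eta by rewrite gt_min ltr_pdivrMr// ltr_pMr// ltr1n.
  have k2 : k <= c - a by rewrite ge_min lexx orbT.
  have := He (- k); rewrite /= normrN gtr0_norm// => /(_ k1).
  have -> : `[a, b]%classic (c - k) by rewrite /= in_itv/=; lra.
  move=> /(_ isT); have := below (c - k); rewrite distrC.
  have /= := ler_normD (u c - u (c - k)) (u (c - k)); rewrite subrK.
  have ack : a <= c - k by lra.
  have ckc : c - k < c by lra.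
  move=> h1 /(_ ack ckc) h2 h3; nra.
have [tc|ct] := leP t c.
  have [->//|tc'] := eqVneq t c; apply: below; first by case/andP: tab.
  by rewrite lt_neqAle tc'.
have cb' : c < b by case/andP: tab => _; exact: lt_le_trans.
have acb : a <= c <= b by rewrite ac cb.
have hM := hb c acb atc.
(* The slack between the speed at [c] and [M] pays for the remainder of the first-order expansion,
   so the bound persists up to [c + k], against the choice of [c]. *)
have e0 : 0 < M - `|du c| by rewrite subr_gt0.
have /is_derive_withinP/(_ _ e0)/nbhs_norm0P[/= eta eta0 He] := hd c acb.
pose k := Num.min (eta / 2) (b - c).
have k0 : 0 < k by rewrite lt_min divr_gt0//= subr_gt0.
have k1 : k < eta by rewrite gt_min ltr_pdivrMr// ltr_pMr// ltr1n.
have k2 : k <= b - c by rewrite ge_min lexx orbT.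
have Sck : S (c + k).
  split; first by lra.
  move=> s /andP[as_ sck]; have [sc|cs] := ltP s c; first exact: below.
  have sk : `|s - c| = s - c by rewrite ger0_norm// subr_ge0.
  have := He (s - c); rewrite /= sk.
  have -> : s - c < eta by lra.
  have -> : c + (s - c) = s by ring.
  have -> : `[a, b]%classic s by rewrite /= in_itv/=; lra.
  move=> /(_ isT isT) h1.
  have h2 : `|u s| <= `|u s - u c - (s - c) *: du c| +
      (`|u c| + `|(s - c) *: du c|).
    apply: le_trans (lerD (lexx _) (ler_normD _ _)).
    by apply: le_trans (ler_normD _ _); rewrite addrCA subrK addrC subrK.
  rewrite normrZ sk in h2.
  nra.
have : c + k <= c by exact: ub_le_sup.
by lra.
Qed.

End derivatives_within.

(** Chain rule along a line. It uses the derivative in direction [v] alone, so partial derivatives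
    suffice later without total differentiability. *)
Lemma derivable_is_derive_within {R : realType} {V W : normedModType R}
    (f : V -> W) (q v : V) (b t : R) (A : set R) :
  derivable f (q + (t * b) *: v) v ->
  is_derive_within A (fun s => f (q + (s * b) *: v)) t
    (b *: 'D_v f (q + (t * b) *: v)).
Proof.
set c := q + _ => dfc; apply/is_derive_withinP => e e0.
have H : is_derive_within [set: R] (fun s => f (c + s *: v)) 0 ('D_v f c).
  rewrite /is_derive_within /diff_quot_within.
  rewrite (_ : (fun _ => _) = (fun h => h^-1 *: ((f \o shift c) (h *: v) - f c))).
    by apply: cvg_trans dfc; apply: cvg_app; exact: cvg_within.
  by apply/funext => h /=; rewrite add0r scale0r addr0 [h *: v + c]addrC.
(* The added 1 covers [b = 0]. *)
have e1 : 0 < e / (`|b| + 1) by exact/divr_gt0/ltr_wpDl.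
have /is_derive_withinP/(_ _ e1) Hc := H.
have kb : (fun k : R => k * b) @ 0 --> (0 : R).
  by rewrite -[X in _ --> X](mul0r b); apply: cvgM; [exact: cvg_id|exact: cvg_cst].
near=> k => _.
have : [set: R] (0 + k * b) ->
  `|f (c + (0 + k * b) *: v) - f (c + 0 *: v) - (k * b) *: 'D_v f c| <=
    e / (`|b| + 1) * `|k * b| by near: k; exact: kb _ Hc.
move=> /(_ I); rewrite add0r scale0r addr0 mulrDl scalerDl addrA -/c scalerA.
move=> /le_trans; apply; rewrite normrM mulrCA [leLHS]mulrC ler_wpM2r//.
by rewrite -mulrA ler_piMr ?(ltW e0)// mulrC ler_pdivrMr ?ltr_wpDl// mul1r lerDl.
Unshelve. all: by end_near.
Qed.

(** * Sup norm of column vectors and mean value estimates *)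

Section norm_cV.
Context {R : realType} {d : nat}.
Implicit Types v w : 'cV[R]_d.

Lemma cV_norm_le v e : 0 <= e -> (forall i, `|v i 0| <= e) -> `|v| <= e.
Proof.
move=> e0 H; rewrite [leLHS]mx_normrE; apply/bigmax_leP; split=> // -[i j] _ /=.
by rewrite (ord1 j).
Qed.

Lemma cV_norm_ge v i : `|v i 0| <= `|v|.
Proof.
rewrite [leRHS]mx_normrE.
exact: (le_bigmax _ (fun ij : 'I_d * 'I_1 => `|v ij.1 ij.2|) (i, 0)).
Qed.

Lemma jacobian_x_mul (f : R -> 'cV[R]_d -> 'cV[R]_d) s y w :
  jacobian_x f s y *m w = \sum_j w j 0 *: partial_x j f s y.
Proof.
apply/colP => i; rewrite mxE summxE; apply: eq_bigr => j _.
by rewrite !mxE mulrC.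
Qed.

(** The factor [d] counts the columns; in the sup norm each entry of [w] is at most [|w|]. *)
Lemma jacobian_x_norm (f : R -> 'cV[R]_d -> 'cV[R]_d) s y w M :
  (forall j, `|partial_x j f s y| <= M) ->
  `|jacobian_x f s y *m w| <= d%:R * M * `|w|.
Proof.
move=> HM; rewrite jacobian_x_mul; apply: le_trans (ler_norm_sum _ _ _) _.
rewrite -mulrA mulr_natl -[X in _ *+ X]card_ord -sumr_const.
apply: ler_sum => j _; rewrite normrZ mulrC.
by apply: ler_pM => //; exact: cV_norm_ge.
Qed.

End norm_cV.

Lemma is_derive_within_cst {R : realType} {V : normedModType R} (A : set R)
    (c : V) t :
  is_derive_within A (fun=> c) t 0.
Proof.
rewrite /is_derive_within /diff_quot_within subrr.
under eq_fun do rewrite scaler0.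
exact: cvg_cst.
Qed.

Lemma segment_mean_value {R : realType} {V W : normedModType R}
    (f : V -> W) (q v : V) (b M : R) :
  (forall s, 0 <= s <= 1 -> derivable f (q + (s * b) *: v) v /\
    `|'D_v f (q + (s * b) *: v)| <= M) ->
  `|f (q + b *: v) - f q| <= M * `|b|.
Proof.
(* [cone_invariance] needs a speed strictly below the slope, hence slope [M * |b| + k] with [k]
   arbitrarily small. *)
move=> H; apply/ler_addgt0Pr => k k0.
have M0 : 0 <= M.
  have [|_] := H 0; first by rewrite lexx ler01.
  exact: le_trans.
have Mb0 : 0 <= M * `|b| by rewrite mulr_ge0.
have := @cone_invariance _ W 0 1 (M * `|b| + k)
  (fun s => f (q + (s * b) *: v) - f q)
  (fun s => b *: 'D_v f (q + (s * b) *: v) - 0).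
move=> /(_ (ltr_wpDl Mb0 k0)).
rewrite mul0r scale0r addr0 subrr => /(_ erefl).
move=> cone; have := cone _ _ 1; rewrite subr0 mulr1 mul1r; apply.
- move=> s /H[Hd _]; apply: is_derive_withinB; last exact: is_derive_within_cst.
  exact: derivable_is_derive_within.
- move=> s /H[_ HM] _; rewrite subr0 normrZ mulrC ltr_pwDr//.
  by rewrite ler_wpM2r.
- by lra.
Qed.

Lemma convex_norm_le {R : realType} {V : normedModType R} (a v : V) (s e : R) :
  0 <= s <= 1 -> `|a| <= e -> `|a + v| <= e -> `|a + s *: v| <= e.
Proof.
move=> /andP[s0 s1] ae ave.
rewrite (_ : a + s *: v = (1 - s) *: a + s *: (a + v)); last first.
  by rewrite scalerDr addrA -scalerDl subrK scale1r.
apply: le_trans (ler_normD _ _) _; rewrite !normrZ !ger0_norm ?subr_ge0//.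
have := normr_ge0 a; have := normr_ge0 (a + v); nra.
Qed.

(** Passing from [xi] to [eta] one coordinate at a time uses one partial derivative per move. The
    intermediate points stay in the ball because a sup-norm ball is a box. *)
Lemma ball_lipschitz {R : realType} {d : nat} {W : normedModType R}
    (g : 'cV[R]_d -> W) (c : 'cV[R]_d) (rho M : R) :
  (forall j xi, `|xi - c| < rho -> derivable g xi (delta_mx j 0) /\
    `|'D_(delta_mx j 0) g xi| <= M) ->
  forall xi eta, `|xi - c| < rho -> `|eta - c| < rho ->
    `|g eta - g xi| <= d%:R * M * `|eta - xi|.
Proof.
move=> H xi eta hxi heta.
pose w k : 'cV[R]_d := \col_i if (i < k)%N then eta i 0 else xi i 0.
(* A closed radius below [rho], since the coordinatewise and convexity bounds are non-strict. *)
pose e := Num.max `|xi - c| `|eta - c|.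
have erho : e < rho by rewrite gt_max hxi.
have we k : `|w k - c| <= e.
  apply: cV_norm_le => [|i]; first by rewrite le_max normr_ge0.
  rewrite !mxE le_max; case: ifP => _.
    by have := cV_norm_ge (eta - c) i; rewrite !mxE => ->; rewrite orbT.
  by have := cV_norm_ge (xi - c) i; rewrite !mxE => ->.
have w0 : w 0%N = xi by apply/colP => i; rewrite mxE.
have wd : w d = eta by apply/colP => i; rewrite mxE ltn_ord.
have wS (k : 'I_d) : w k.+1 = w k + (eta - xi) k 0 *: delta_mx k 0.
  apply/colP => i; rewrite !mxE ltnS leq_eqVlt eqxx andbT -val_eqE/=.
  case: ltngtP => [_|_|/val_inj ->] /=; rewrite ?mulr0 ?addr0//.
  by rewrite mulr1 addrC subrK.
rewrite -[in leLHS]wd -[in leLHS]w0 -(telescope_sumr (fun k => g (w k)) (leq0n d)) big_mkord.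
apply: le_trans (ler_norm_sum _ _ _) _.
rewrite -mulrA mulr_natl -[X in _ *+ X]card_ord -sumr_const.
apply: ler_sum => k _; rewrite wS.
have M0 : 0 <= M by have [_] := H k _ hxi; exact: le_trans.
apply: le_trans (_ : M * `|(eta - xi) k 0| <= _); last first.
  by rewrite ler_wpM2l// cV_norm_ge.
apply: segment_mean_value => s s01; apply: H; apply: le_lt_trans erho.
rewrite addrAC -scalerA; apply: convex_norm_le => //.
by rewrite addrAC -wS.
Qed.

(** * Uniform constants along a compact curve *)

Lemma uniform_tube {R : realType} {V : normedModType R} (a b : R) (x : R -> V)
    (P : R -> R -> set V -> Prop) :
  (forall s M M' U U', M <= M' -> U' `<=` U -> P s M U -> P s M' U') ->
  (forall t, a <= t <= b -> forall e, 0 < e ->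
    \forall s \near t, a <= s <= b -> `|x s - x t| < e) ->
  (forall t, a <= t <= b -> exists M e, 0 < e /\
    \forall s \near t, a <= s <= b -> P s M [set xi | `|xi - x t| < e]) ->
  exists M rho, [/\ 0 < M, 0 < rho &
    forall s, a <= s <= b -> P s M [set xi | `|xi - x s| < rho]].
Proof.
move=> mono xc loc.
have /compact_near_coveringP/near_covering_withinP cov := @segment_compact R a b.
(* A single parameter tending to infinity is both the bound and the inverse of the radius, so
   compactness delivers the two constants together. *)
pose Q (M s : R) := P s M [set xi | `|xi - x s| < M^-1].
have [|M0 [_ HM0]] := cov R (+oo%R : set_system R) Q _.
  move=> t; rewrite /= in_itv/= => tab.
  have [M [e [e0 H]]] := loc _ tab.
  (* One half of [e] is for the motion of the centre from [x t] to [x s], the other for the radius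
     around [x s]. *)
  have e20 : 0 < e / 2 by rewrite divr_gt0.
  have H' := xc _ tab _ e20.
  near=> s M' => /=; rewrite in_itv/= => sab.
  have Ps : P s M [set xi | `|xi - x t| < e] by move: sab; near: s.
  apply: mono Ps => [|xi /= hxi]; first by near: M'; exact/nbhs_pinfty_ge/num_real.
  have h1 : `|x s - x t| < e / 2 by move: sab; near: s.
  have h2 : M'^-1 < e / 2.
    have M'0 : 0 < M' by near: M'; exact/nbhs_pinfty_gt/num_real.
    have : (e / 2)^-1 < M' by near: M'; exact/nbhs_pinfty_gt/num_real.
    by rewrite -[X in _ -> _ < X]invrK ltf_pV2 ?posrE ?invr_gt0.
  have := ler_distD (x s) xi (x t); lra.
pose M := Num.max 1 (M0 + 1).
have M1 : 0 < M by rewrite lt_max ltr01.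
exists M, M^-1; split=> //; first by rewrite invr_gt0.
move=> s sab; apply: (HM0 M _ s); last by rewrite /= in_itv.
by rewrite lt_max ltrDl ltr01 orbT.
Unshelve. all: by end_near.
Qed.

(** * Uniqueness for initial value problems on short intervals *)

Section ivp.
Context {R : realType} {V : normedModType R}.
Implicit Types (F : R -> V -> V) (u v : R -> V).

Lemma ivp_solution_restrict {dom : R -> set V} {F} {a b : R} b' {u0 : V} {u} :
  b' <= b -> ivp_solution dom F a b u0 u -> ivp_solution dom F a b' u0 u.
Proof.
move=> b'b [u_a H]; split=> // t; rewrite in_itv/= => /andP[at_ tb'].
have [|dt Ht] := H t; first by rewrite in_itv/= at_ (le_trans tb').
split=> //; apply: is_derive_within_subset Ht => s.
by rewrite /= !in_itv/= => /andP[-> /le_trans]; apply.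
Qed.

(** Inside a cone of slope [M] the difference has speed at most [K * M * (b - a) < M], so every
    positive slope confines it. The slope [e / (t - a + 1)] gives a value at most [e], also at
    [t = a]. *)
Lemma ivp_unique F (a b K : R) (u0 : V) u v :
  0 <= K -> K * (b - a) < 1 ->
  (forall t xi eta, `|F t xi - F t eta| <= K * `|xi - eta|) ->
  ivp_solution (fun=> setT) F a b u0 u -> ivp_solution (fun=> setT) F a b u0 v ->
  forall t, a <= t <= b -> u t = v t.
Proof.
move=> K0 Kab FK [ua hu] [va hv] t tab; apply/eqP.
rewrite -subr_eq0 -normr_le0; apply/ler_addgt0Pl => e e0.
rewrite addr0.
have ta0 : 0 < t - a + 1 by lra.
have M0 : 0 < e / (t - a + 1) by exact: divr_gt0.
apply: le_trans (_ : e / (t - a + 1) * (t - a) <= e); last first.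
  by rewrite -mulrA ler_piMr ?(ltW e0)// mulrC ler_pdivrMr// mul1r lerDl.
apply: (@cone_invariance _ _ a b _ (u \- v) (fun s => F s (u s) - F s (v s))) => //.
- by rewrite /= ua va subrr.
- by move=> s sab; apply: is_derive_withinB; [apply hu|apply hv]; rewrite in_itv.
- move=> s sab /= hs; apply: le_lt_trans (FK _ _ _) _.
  set M := e / _ in M0 hs *.
  apply: le_lt_trans (_ : K * (M * (b - a)) < _).
    apply: ler_wpM2l => //; apply: le_trans hs _; rewrite ler_wpM2l//; [exact: ltW|lra].
  by rewrite mulrCA gtr_pMr.
Qed.

End ivp.

(** * Local error of the composite scheme *)

Section consistency.
Context {R : realType} {d : nat}.
Local Notation V := 'cV[R]_d.

(** The auxiliary ODE sees [phi_increment] at all intermediate times, whereas the order condition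
    speaks of the end of a step. It is therefore applied to each shorter step [t - s]. *)
Lemma linear_step_error {t0 T : R} {f : R -> V -> V} {x : R -> V}
    {Lambda1 : R -> V -> R -> V} {r : R} (K : R) : 0 < K -> 0 <= r ->
  (forall s (w : V), t0 <= s <= T -> `|jacobian_x f s (x s) *m w| <= K * `|w|) ->
  linear_order t0 T f x Lambda1 r ->
  exists c delta0 : R, [/\ 0 < c, 0 < delta0 &
    forall s delta, t0 <= s -> 0 < delta <= delta0 -> s + delta <= T ->
    exists2 z, ivp_solution (fun=> setT) (linear_rhs `[t0, T] f s (x s))
        s (s + delta) (x s) z &
      forall t, s <= t <= s + delta ->
        `|z t - (x s + phi_increment Lambda1 s (x s) (t - s))|
          <= c * delta `^ (r + 1)].
Proof.
move=> K0 r0 HJ [c [delta0 [d0 H]]].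
(* The bound [(2 * K)^-1] gives [K * delta <= 1 / 2], as required by [ivp_unique]. *)
exists (`|c| + 1), (Num.min delta0 (2 * K)^-1); split.
- by have := normr_ge0 c; lra.
- by rewrite lt_min d0 invr_gt0 mulr_gt0.
move=> s delta t0s /andP[dl]; rewrite le_min => /andP[dd0 dK] sdT.
have [|z hz _] := H s delta t0s _ sdT; first by rewrite dl.
exists z => // t /andP[st tsd].
have G0 : 0 <= (`|c| + 1) * delta `^ (r + 1).
  by rewrite mulr_ge0 ?powR_ge0// addr_ge0.
have [ts|ts] := eqVneq t s.
  by rewrite ts /phi_increment subrr scale0r addr0 (proj1 hz) subrr normr0.
have sd : s + (t - s) = t by ring.
have ts0 : 0 < t - s by rewrite subr_gt0 lt_neqAle eq_sym ts.
have [||z' hz'] := H s (t - s) t0s.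
- by rewrite ts0/=; apply: le_trans dd0; lra.
- by rewrite sd (le_trans tsd).
rewrite sd in hz' *.
(* The order condition supplies a possibly different z for each step size. *)
have -> : z t = z' t.
  apply: (@ivp_unique _ _ (linear_rhs `[t0, T] f s (x s)) s t K (x s)) => //.
  - exact: ltW.
  - apply: le_lt_trans (_ : K * (2 * K)^-1 < 1).
      by rewrite ler_pM2l//; apply: le_trans dK; lra.
    by rewrite invfM mulrCA divff ?gt_eqF// mulr1 invf_lt1// ltr1n.
  - move=> t' xi eta; rewrite /linear_rhs opprD addrACA subrr addr0 -mulmxBr.
    by apply: HJ; rewrite t0s/=; lra.
  - exact: ivp_solution_restrict hz.
  - by rewrite lexx andbT.
rewrite (proj1 hz') opprD addrA => /le_trans; apply.
apply: le_trans (_ : (`|c| + 1) * (t - s) `^ (r + 1) <= _).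
  by rewrite ler_wpM2r ?powR_ge0//; have := ler_norm c; lra.
rewrite ler_wpM2l ?addr_ge0//; apply: ge0_ler_powR; rewrite ?nnegrE; lra.
Qed.

Lemma powR_le_id (a e : R) : 0 < a <= 1 -> 0 <= e -> a `^ (e + 1) <= a.
Proof.
move=> a01 e0; rewrite -[leRHS]powRr1; last by case/andP: a01 => /ltW.
by apply: ger_powR => //; rewrite lerDr.
Qed.

(** [f] is Lipschitz only within [rho] of the graph of [x], so one bootstrap has to yield the
    smallness of the deviation and the membership in the tube simultaneously. *)
Lemma local_error {t0 T : R} {D : set V} {f : R -> V -> V} {x : R -> V} {x0 : V}
    {Lambda1 : R -> V -> R -> V} {Lambda2 : V -> R -> V -> R -> V} {r p : R}
    (K rho : R) : 0 < K -> 0 < rho -> 0 <= r -> 0 <= p ->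
  (forall s (w : V), t0 <= s <= T -> `|jacobian_x f s (x s) *m w| <= K * `|w|) ->
  (forall s (xi eta : V), t0 <= s <= T -> `|xi - x s| < rho -> `|eta - x s| < rho ->
     `|f s eta - f s xi| <= K * `|eta - xi|) ->
  ivp_solution (fun=> D) f t0 T x0 x ->
  linear_order t0 T f x Lambda1 r ->
  auxiliary_order t0 T D f x Lambda1 Lambda2 p ->
  exists C delta0 : R, [/\ 0 < C, 0 < delta0 &
    forall s delta, t0 <= s -> 0 < delta <= delta0 -> s + delta <= T ->
    `|x (s + delta) - (x s + delta *: Lambda1 s (x s) delta
        + delta *: Lambda2 (x s) s 0 delta)|
      <= C * delta `^ (Num.min r p + 1)].
Proof.
move=> K0 rho0 r0 p0 HJ Hf [_ hx] /(linear_step_error K K0 r0 HJ).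
case=> [c1 [d1 [c10 d10 H1]]] [c2 [d2 [d20 H2]]].
(* One [c1] bounds the deviation, the other the linear integrator; [|c2|] bounds the auxiliary
   one. *)
exists (2 * c1 + `|c2|).
(* Here 1 makes powers of [delta] decrease in the exponent, [(4 * K)^-1] closes the cone argument,
   and [rho / (4 * c1)] keeps the argument of [f] in the tube. *)
exists (Num.min (Num.min d1 d2) (Num.min (Num.min 1 (4 * K)^-1) (rho / (4 * c1)))).
split; first by have := normr_ge0 c2; lra.
  by rewrite !lt_min d10 d20 ltr01/= invr_gt0 divr_gt0 ?mulr_gt0.
move=> s delta t0s /andP[dl]; rewrite !le_min.
move=> /and3P[/andP[dd1 dd2] /andP[dle1 dK] drho] sdT.
have dl01 : 0 < delta <= 1 by rewrite dl.
have [|z [zs hz] hg] := H1 s delta t0s _ sdT; first by rewrite dl.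
have [|v [vs hv] hv2] := H2 s delta t0s _ sdT; first by rewrite dl.
pose G := c1 * delta `^ (r + 1).
have G0 : 0 < G by rewrite mulr_gt0// powR_gt0.
have Grho : G < rho / 2.
  have : G <= c1 * delta by rewrite ler_pM2l// powR_le_id.
  move: drho; rewrite ler_pdivlMr ?mulr_gt0//; nra.
have dK1 : 4 * K * delta <= 1.
  by rewrite mulrC -ler_pdivlMr ?mulr_gt0// mul1r.
have M0 : 0 < 4 * K * G by rewrite mulr_gt0// mulr_gt0.
(* No exponential is needed: the slope 4 K G of the cone already exceeds
   K (|e| + |g|) + K |g| <= 3 K G, since 4 K delta <= 1 keeps |e| <= G in it. *)
have cone : forall t, s <= t <= s + delta ->
    `|z t + v t - x t| <= 4 * K * G * (t - s).
  apply: (@cone_invariance _ _ s (s + delta) _ ((z \+ v) \- x)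
    (fun t => linear_rhs `[t0, T] f s (x s) t (z t)
       + auxiliary_rhs `[t0, T] f Lambda1 s (x s) t (v t) - f t (x t))) => //.
  - by rewrite /= zs vs addr0 subrr.
  - move=> t tsd; have tI : t \in `[s, s + delta] by rewrite in_itv.
    apply: is_derive_withinB.
      by apply: is_derive_withinD; [apply hz|apply hv].
    apply: is_derive_within_subset (proj2 (hx t _)).
      by move=> t'; rewrite /= !in_itv/=; lra.
    by rewrite in_itv/=; lra.
  - move=> t tsd /= et; have tT : t0 <= t <= T by lra.
    set J := jacobian_x f s (x s).
    set phi := phi_increment Lambda1 s (x s) (t - s).
    have gt := hg t tsd; rewrite -/phi -/G in gt.
    have eG : `|z t + v t - x t| <= G.
      apply: le_trans et _; apply: le_trans (_ : 4 * K * G * delta <= _).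
        by rewrite ler_pM2l//; lra.
      by rewrite mulrAC ler_piMl// ltW.
    have -> : linear_rhs `[t0, T] f s (x s) t (z t)
       + auxiliary_rhs `[t0, T] f Lambda1 s (x s) t (v t) - f t (x t)
       = f t (x s + phi + v t) - f t (x t) + J *m (z t - (x s + phi)).
      rewrite /linear_rhs /auxiliary_rhs -/J -/phi mulmxBr mulmxDr.
      by apply/colP => i; rewrite !mxE; ring.
    (* x s + phi + v t = x t + e t - g t, in the notation of the header *)
    have ey : `|x s + phi + v t - x t| <= 2 * G.
      rewrite (_ : _ - _ = (z t + v t - x t) - (z t - (x s + phi))); last first.
        by apply/colP => i; rewrite !mxE; ring.
      by apply: le_trans (ler_normB _ _) _; lra.
    apply: le_lt_trans (ler_normD _ _) _.
    have h1 : `|J *m (z t - (x s + phi))| <= K * G.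
      by apply: le_trans (HJ _ _ _) _; [lra|rewrite ler_pM2l].
    have h2 : `|f t (x s + phi + v t) - f t (x t)| <= K * (2 * G).
      apply: le_trans (Hf _ _ _ tT _ _) _; last by rewrite ler_pM2l.
        by rewrite subrr normr0.
      by apply: le_lt_trans ey _; lra.
    nra.
have dmin e : Num.min r p <= e -> delta `^ (e + 1) <= delta `^ (Num.min r p + 1).
  by move=> he; apply: ger_powR => //; rewrite lerD2r.
set P := delta `^ (Num.min r p + 1).
have sds : s <= s + delta <= s + delta by lra.
have eP : `|z (s + delta) + v (s + delta) - x (s + delta)| <= c1 * P.
  apply: le_trans (cone _ sds) _; apply: le_trans (_ : G <= _); last first.
    by rewrite ler_pM2l// dmin// ge_min lexx.
  by rewrite addrAC subrr add0r mulrAC ler_piMl// ltW.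
have gP : `|z (s + delta) - (x s + delta *: Lambda1 s (x s) delta)| <= c1 * P.
  have := hg _ sds; rewrite /phi_increment addrAC subrr add0r => /le_trans; apply.
  by rewrite ler_pM2l// dmin// ge_min lexx.
have vP : `|v (s + delta) - delta *: Lambda2 (x s) s 0 delta| <= `|c2| * P.
  apply: le_trans hv2 _; apply: le_trans (_ : `|c2| * delta `^ (p + 1) <= _).
    by rewrite ler_wpM2r ?powR_ge0// ler_norm.
  by rewrite ler_wpM2l// dmin// ge_min lexx orbT.
rewrite (_ : _ - _ = - (z (s + delta) + v (s + delta) - x (s + delta))
   + (z (s + delta) - (x s + delta *: Lambda1 s (x s) delta))
   + (v (s + delta) - delta *: Lambda2 (x s) s 0 delta)); last first.
  by apply/colP => i; rewrite !mxE; ring.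
apply: le_trans (ler_normD _ _) _; rewrite mulrDl lerD//.
by apply: le_trans (ler_normD _ _) _; rewrite normrN; lra.
Qed.

End consistency.

(** * Accumulation of local errors for a one-step method *)

Lemma one_step_convergence {R : realType} {V : normedModType R} {t0 T : R}
    {x : R -> V} {Phi : R -> V -> R -> V} {L rho C delta0 q : R} :
  t0 < T -> 0 <= L -> 0 < rho -> 0 < C -> 0 < delta0 -> 0 < q ->
  (forall s h y, t0 <= s <= T -> 0 < h < 1 -> `|y - x s| < rho ->
     `|Phi s y h - Phi s (x s) h| <= L * `|y - x s|) ->
  (forall s delta, t0 <= s -> 0 < delta <= delta0 -> s + delta <= T ->
     `|x (s + delta) - (x s + delta *: Phi s (x s) delta)|
       <= C * delta `^ (q + 1)) ->
  exists C' h0 : R, [/\ 0 < C', 0 < h0 &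
    forall (h : R) (N : nat) (t : nat -> R) (y : nat -> V),
      0 < h < 1 -> h <= h0 -> time_partition t0 T h N t -> y 0%N = x t0 ->
      (forall n, (n < N)%N ->
         y n.+1 = y n + (t n.+1 - t n) *: Phi (t n) (y n) (t n.+1 - t n)) ->
      forall n, (n <= N)%N -> `|x (t n) - y n| <= C' * h `^ q].
Proof.
move=> t0T L0 rho0 C0 d00 q0 HL HC.
(* [C'] is the final value at [T] of the majorant [g] below, stripped of [h ^ q]. *)
have [C' C'0 C'E] : exists2 C', 0 < C' & C' = C * ((T - t0) * expR (L * (T - t0))).
  by eexists; last reflexivity; rewrite mulr_gt0// mulr_gt0 ?expR_gt0// subr_gt0.
have a0 : 0 < rho / (2 * C') by rewrite divr_gt0// mulr_gt0.
(* The second bound forces [C' * h ^ q <= rho / 2], which keeps every iterate in the tube. *)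
exists C', (Num.min delta0 ((rho / (2 * C')) `^ q^-1)).
split=> //; first by rewrite lt_min d00 powR_gt0.
move=> h N t y /andP[h0 h1]; rewrite le_min => /andP[hd hrho] [tt0 tN tS] y0 yS.
have hq0 : 0 < h `^ q by rewrite powR_gt0.
have C'h : C' * h `^ q < rho.
  have : h `^ q <= rho / (2 * C').
    apply: le_trans (ge0_ler_powR _ _ _ hrho) _.
    - exact: ltW.
    - by rewrite nnegrE ltW.
    - by rewrite nnegrE powR_ge0.
    - by rewrite -powRrM mulVf ?gt_eqF// powRr1// ltW.
  rewrite ler_pdivlMr ?mulr_gt0// mulrCA [h `^ q * C']mulrC.
  have : 0 < C' * h `^ q by exact: mulr_gt0.
  lra.
have t_ge n : (n <= N)%N -> t0 <= t n.
  elim: n => [|n IH] nN; first by rewrite tt0.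
  by apply: le_trans (IH (ltnW nN)) _; apply/ltW; have [] := tS n nN.
have t_le n : (n <= N)%N -> t n <= T.
  (* Induction backwards from the last node, where [t N = T] is known. *)
  move=> /subnKC; move: (N - n)%N => m; elim: m n => [|m IH] n.
    by rewrite addn0 => ->; rewrite tN.
  rewrite addnS -addSn => Hm; apply: le_trans (IH _ Hm); apply/ltW.
  by have [] := tS n; rewrite -?Hm ?leq_addr.
(* Continuous majorant of the error: it vanishes at [t0], grows linearly with the accumulated local
   errors, and exponentially with their propagation. *)
pose g s := C * h `^ q * ((s - t0) * expR (L * (s - t0))).
have gT s : t0 <= s <= T -> g s <= C' * h `^ q.
  move=> /andP[s0 sT]; rewrite /g C'E [leRHS]mulrAC ler_pM2l ?mulr_gt0//.
  apply: ler_pM; rewrite ?subr_ge0 ?expR_ge0// ?lerB// ler_expR ler_wpM2l//.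
  by rewrite lerB.
suff key n : (n <= N)%N -> `|x (t n) - y n| <= g (t n).
  by move=> n nN; apply: le_trans (key n nN) (gT _ _); rewrite t_ge ?t_le.
elim: n => [|n IH] nN.
  by rewrite y0 tt0 subrr normr0 /g subrr mul0r mulr0.
have {}IH := IH (ltnW nN); have [tn tnh] := tS n nN.
have tn0 := t_ge n (ltnW nN); have tn1 := t_le _ nN.
rewrite (yS _ nN); set k := t n.+1 - t n.
have k0 : 0 < k by rewrite subr_gt0.
have kh : k <= h by [].
have tk : t n.+1 = t n + k by rewrite /k; ring.
have tnT : t0 <= t n <= T by lra.
have yrho : `|y n - x (t n)| < rho.
  by rewrite distrC; apply: le_lt_trans (le_trans IH (gT _ tnT)) C'h.
(* Only [q] of the [q + 1] powers of the step are replaced by [h]; the remaining factor [k] sums to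
   elapsed time. *)
have e1 : `|x (t n.+1) - (x (t n) + k *: Phi (t n) (x (t n)) k)|
    <= C * (h `^ q * k).
  rewrite tk; apply: le_trans (HC _ _ _ _ _) _ => //; [|by rewrite -tk|].
    by rewrite k0 (le_trans kh).
  rewrite ler_pM2l// powRD ?powRr1 ?(ltW k0)//; last first.
    by rewrite (gt_eqF k0) implybT.
  rewrite ler_pM2r//; apply: ge0_ler_powR; rewrite ?nnegrE; lra.
have e2 : `|Phi (t n) (y n) k - Phi (t n) (x (t n)) k| <= L * g (t n).
  apply: le_trans (HL _ _ _ tnT _ yrho) _; first by lra.
  by rewrite distrC ler_wpM2l.
have -> : x (t n.+1) - (y n + k *: Phi (t n) (y n) k) =
    x (t n.+1) - (x (t n) + k *: Phi (t n) (x (t n)) k)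
    + ((x (t n) - y n) - k *: (Phi (t n) (y n) k - Phi (t n) (x (t n)) k)).
  rewrite scalerBr opprB [x (t n) - _ + _]addrACA [RHS]addrA subrK.
  by rewrite -opprD.
apply: le_trans (ler_normD _ _) _.
have e3 : `|(x (t n) - y n) - k *: (Phi (t n) (y n) k - Phi (t n) (x (t n)) k)|
    <= g (t n) * (1 + L * k).
  apply: le_trans (ler_normB _ _) _; rewrite normrZ gtr0_norm//.
  rewrite mulrDr mulr1 lerD// (_ : g _ * _ = k * (L * g (t n))); last by ring.
  by rewrite ler_pM2l.
apply: le_trans (lerD e1 e3) _.
rewrite /g tk (_ : t n + k - t0 = t n - t0 + k); last by ring.
rewrite [L * (_ + k)]mulrDr expRD.
(* The growth factor [1 + L * k] is absorbed by [expR (L * k)], and the new local error by the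
   increment [k] of elapsed time, as both exponentials are at least 1. *)
have g1 := expR_ge1Dx (L * k).
have g2 : 1 <= expR (L * (t n - t0)).
  by apply: le_trans (expR_ge1Dx _); rewrite lerDl mulr_ge0// subr_ge0.
move: (expR _) g2 => E1 g2; move: (expR _) g1 => E2 g1.
have Lk : 0 <= L * k by rewrite mulr_ge0// ltW.
rewrite [leLHS](_ : _ = C * h `^ q * (k + (t n - t0) * (E1 * (1 + L * k)))); last by ring.
rewrite ler_pM2l ?mulr_gt0//.
have E20 : 1 <= E2 by lra.
have E12 : 1 <= E1 * E2 by nra.
have h3 : E1 * (1 + L * k) <= E1 * E2 by rewrite ler_wpM2l//; lra.
have h4 : (t n - t0) * (E1 * (1 + L * k)) <= (t n - t0) * (E1 * E2).
  by rewrite ler_wpM2l// subr_ge0.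
by rewrite [leRHS]mulrDl [leRHS]addrC lerD// ler_peMr// ltW.
Qed.

(** * Lipschitz and derivative bounds on a tube around the solution *)

Section tubes.
Context {R : realType} {d : nat} {t0 T : R} {D : set 'cV[R]_d}.
Context {x : R -> 'cV[R]_d}.
Local Notation V := 'cV[R]_d.
Context (xD : forall t, t0 <= t <= T -> D (x t)).
Context (x_cont : forall t, t0 <= t <= T -> forall e, 0 < e ->
  \forall s \near t, t0 <= s <= T -> `|x s - x t| < e).

Lemma lipschitz_tube (F : R -> V -> R -> V) : locally_lipschitz t0 T D F ->
  exists L rho, [/\ 0 < L, 0 < rho & forall s h y, t0 <= s <= T -> 0 < h < 1 ->
    `|y - x s| < rho -> `|F s y h - F s (x s) h| <= L * `|y - x s|].
Proof.
move=> HF.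
pose P (s M : R) (U : set V) := forall h xi1 xi2, 0 < h < 1 -> U xi1 -> U xi2 ->
  `|F s xi2 h - F s xi1 h| <= M * `|xi2 - xi1|.
have [||M [rho [M0 rho0 H]]] := @uniform_tube _ _ t0 T x P _ x_cont.
- move=> s M M' U U' MM UU HP h xi1 xi2 h01 /UU U1 /UU U2.
  by apply: le_trans (HP _ _ _ h01 U1 U2) _; rewrite ler_wpM2r.
- move=> t tT; have [U [/nbhs_normP[e /= e0 eU] _] [B B0 HB]] := HF _ (xD _ tT).
  exists B, e; split=> //.
  (* The local constant already serves all times, so nothing is asked of [s] beyond lying in the
     interval. *)
  apply: (@nearW _ (nbhs t)) => s sT h xi1 xi2 h01 U1 U2.
  by apply: HB => //; apply: eU; rewrite /ball_/= distrC.
- exists M, rho; split=> // s h y sT h01 yrho.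
  by apply: (H s sT h) => //=; rewrite subrr normr0.
Qed.

Lemma class_C_continuous k (I : set R) (f : R -> V -> V) :
  class_C k I D f -> {within I `*` D, continuous (fun p : R * V => f p.1 p.2)}.
Proof. by case: k => [|k] []. Qed.

Lemma partial_x_tube (k : nat) (f : R -> V -> V) : open D ->
  class_C k.+1 `[t0, T] D f ->
  exists M rho, [/\ 0 < M, 0 < rho & forall s, t0 <= s <= T ->
    forall j xi, `|xi - x s| < rho ->
    derivable (f s) xi (delta_mx j 0) /\ `|partial_x j f s xi| <= M].
Proof.
move=> oD [_ [_ derf _ df]].
pose P (s M : R) (U : set V) := forall j xi, U xi ->
  derivable (f s) xi (delta_mx j 0) /\ `|partial_x j f s xi| <= M.
have [||M [rho [M0 rho0 H]]] := @uniform_tube _ _ t0 T x P _ x_cont; last 1 first.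
- by exists M, rho; split=> // s sT j xi; exact: H.
- move=> s M M' U U' MM UU HP j xi /UU /(HP j)[? h]; split=> //.
  exact: le_trans MM.
(* The sum dominates all the partial derivatives at once; each 1 is the tolerance granted by
   continuity at [(t, x t)]. *)
move=> t tT; pose M := \sum_j (`|partial_x j f t (x t)| + 1).
have near_t : \forall p \near (t, x t), forall j, (`[t0, T] `*` D) p ->
    `|partial_x j f p.1 p.2| <= M.
  apply: (@filter_forall _ _ (fun j p => (`[t0, T] `*` D) p ->
    `|partial_x j f p.1 p.2| <= M) (nbhs (t, x t))) => j.
  have /subspace_continuousP/(_ (t, x t)) := class_C_continuous _ _ _ (df j).
  have tD : (`[t0, T] `*` D) (t, x t) by split=> /=; [rewrite in_itv|exact: xD].
  move=> /(_ tD) /cvgrPdist_le /(_ 1 ltr01); rewrite near_withinE.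
  apply: (@filterS _ (nbhs (t, x t))) => p Hp /Hp {}Hp.
  rewrite /M (bigD1 j)//=; set S := \sum_(_ | _) _.
  have S0 : 0 <= S by rewrite sumr_ge0// => i _; rewrite addr_ge0.
  have := ler_normB (partial_x j f t (x t))
    (partial_x j f t (x t) - partial_x j f p.1 p.2).
  rewrite subKr => h; move: Hp => /= Hp; lra.
have /nbhs_ballP[e /= e0 He] := near_t.
have /nbhs_normP[e' /= e'0 He'] : nbhs (x t) D by apply: oD; exact: xD.
exists M, (Num.min e e'); split; first by rewrite lt_min e0.
have : \forall s \near t, ball t e s by exact: nbhsx_ballx.
apply: filterS => s ts sT j xi /=; rewrite lt_min => /andP[xe xe'].
have Dxi : D xi by apply: He'; rewrite /ball_/= distrC.
split; first by apply: derf => //=; rewrite in_itv.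
apply: (He (s, xi)); last by split=> //=; rewrite in_itv.
by split=> //=; rewrite -ball_normE/= distrC.
Qed.

End tubes.

(** * Convergence of the composite scheme from consistency and stability *)

Theorem theorem15 (R : realType) (d : nat) (t0 T : R) (D : set 'cV[R]_d)
    (x0 : 'cV[R]_d) (gamma : nat) (f : R -> 'cV[R]_d -> 'cV[R]_d)
    (x : R -> 'cV[R]_d)
    (Lambda1 : R -> 'cV[R]_d -> R -> 'cV[R]_d)
    (Lambda2 : 'cV[R]_d -> R -> 'cV[R]_d -> R -> 'cV[R]_d) (r p : R)
    (ht : t0 < T) (hD : open D) (hx0 : D x0) (hgamma : (2 < gamma)%N)
    (hf : class_C gamma.+1 `[t0, T] D f)
    (hx : ivp_solution (fun=> D) f t0 T x0 x)
    (hxu : forall x' : R -> 'cV[R]_d, ivp_solution (fun=> D) f t0 T x0 x' ->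
       forall t, t \in `[t0, T] -> x' t = x t)
    (hr : 0 < r) (hp : 0 < p)
    (hL1 : linear_order t0 T f x Lambda1 r)
    (hL2 : auxiliary_order t0 T D f x Lambda1 Lambda2 p)
    (hLip1 : locally_lipschitz t0 T D Lambda1)
    (hLip2 : locally_lipschitz t0 T D (fun s xi h => Lambda2 xi s 0 h)) :
  exists C h0 : R, [/\ 0 < C, 0 < h0 &
    forall (h : R) (N : nat) (t : nat -> R) (y : nat -> 'cV[R]_d),
      0 < h < 1 -> h <= h0 ->
      time_partition t0 T h N t ->
      composite_scheme Lambda1 Lambda2 N t x0 y ->
      forall n, (n < N)%N ->
        `|x (t n.+1) - y n.+1| <= C * h `^ Num.min r p].

Proof.
have xD t : t0 <= t <= T -> D (x t).
  by move=> tT; apply (proj2 hx); rewrite in_itv.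
have x_cont t : t0 <= t <= T -> forall e, 0 < e ->
    \forall s \near t, t0 <= s <= T -> `|x s - x t| < e.
  move=> tT e e0; have [_] := proj2 hx t ltac:(by rewrite in_itv).
  move=> /is_derive_within_continuous /(_ e e0); rewrite (near_shift 0 t) subr0.
  apply: filterS => s /= Hs sT.
  by move: Hs; rewrite in_itv/= [t + s]addrC; exact.
have [M [rho [M0 rho0 HM]]] := partial_x_tube xD x_cont _ f hD hf.
have [L1 [rho1 [L10 rho10 H1]]] := lipschitz_tube xD x_cont _ hLip1.
have [L2 [rho2 [L20 rho20 H2]]] := lipschitz_tube xD x_cont _ hLip2.
(* The added 1 keeps the constant positive when [d = 0]. *)
have K0 : 0 < d%:R * M + 1 by rewrite ltr_wpDl// mulr_ge0// ltW.
have HJ s (w : 'cV[R]_d) : t0 <= s <= T ->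
    `|jacobian_x f s (x s) *m w| <= (d%:R * M + 1) * `|w|.
  move=> sT; apply: le_trans (_ : d%:R * M * `|w| <= _); last first.
    by rewrite ler_wpM2r// lerDl.
  apply: jacobian_x_norm => j.
  by apply: (proj2 (HM s sT j (x s) _)); rewrite subrr normr0.
have Hf s (xi eta : 'cV[R]_d) : t0 <= s <= T -> `|xi - x s| < rho ->
    `|eta - x s| < rho -> `|f s eta - f s xi| <= (d%:R * M + 1) * `|eta - xi|.
  move=> sT hxi heta; apply: le_trans (_ : d%:R * M * `|eta - xi| <= _); last first.
    by rewrite ler_wpM2r// lerDl.
  exact: ball_lipschitz (HM s sT) _ _ hxi heta.
have [C [delta0 [C0 d00 HC]]] :=
  local_error _ _ K0 rho0 (ltW hr) (ltW hp) HJ Hf hx hL1 hL2.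
(* The composite scheme is a one-step method with this increment. Its Lipschitz constant is
   [L1 + L2] on the thinner tube, with [Lambda2] varied through its base point and its state fixed
   at 0. *)
pose Phi s y h := Lambda1 s y h + Lambda2 y s 0 h.
have L0 : 0 <= L1 + L2 by rewrite addr_ge0// ltW.
have rho120 : 0 < Num.min rho1 rho2 by rewrite lt_min rho10.
have q0 : 0 < Num.min r p by rewrite lt_min hr.
have [||C' [h0 [C'0 h00 H]]] := @one_step_convergence _ _ t0 T x Phi _ _ _ _ _
  ht L0 rho120 C0 d00 q0.
- move=> s h y sT h01; rewrite lt_min => /andP[y1 y2].
  rewrite /Phi opprD addrACA mulrDl; apply: le_trans (ler_normD _ _) _.
  by rewrite lerD ?H1 ?H2.
- move=> s delta t0s dl sdT; rewrite /Phi scalerDr addrA; exact: HC.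
exists C', h0; split=> // h N t y h01 hh0 tp [y0 yS] n nN.
apply: (H _ N) => //; first by rewrite y0 (proj1 hx).
by move=> m mN; rewrite (yS m mN) /Phi scalerDr addrA.
Qed.
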